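(* For integers $n\ge2$ and $0\le t\le n-2$, the number of $(102,012)$-avoiding inversion sequences $e$ of length $n$ with $\mathrm{rank}(e)=t$ is $(t+1)F_{2n-2t-3}$, where $F_k$ denotes the $k$-th Fibonacci number ($F_0=0$, $F_1=1$, $F_k=F_{k-1}+F_{k-2}$).
   Context: An inversion sequence of length $n$ is an integer sequence $e=(e_1,\dots,e_n)$ with $0\le e_j\le j-1$ for all $j$. It contains a pattern $w=w_1w_2w_3$ if there are indices $i_1<i_2<i_3$ such that $e_{i_1}e_{i_2}e_{i_3}$ is order-isomorphic to $w$ (same relations $<,=,>$ between corresponding pairs of entries); otherwise it avoids $w$. ''$(w,w')$-avoiding'' means avoiding both $w$ and $w'$. $\max(e)$ is the largest entry, and $\mathrm{fdes}(e)$ is the position $p$ of the first descent: $e_1\le\cdots\le e_p>e_{p+1}$, with the convention $e_{n+1}=-1$. For a $102$-avoiding $e$, $\mathrm{rank}(e):=\mathrm{fdes}(e)-\max(e)-1$. *)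

(* Defs.v *)
From mathcomp Require Import all_boot all_order all_algebra.

Set Implicit Arguments.
Unset Strict Implicit.
Unset Printing Implicit Defensive.

Import Order.TTheory GRing.Theory Num.Theory.

(* Sequences e = (e_1, ..., e_n) are lists of naturals, so that e_j is the item
   of index j - 1 of the list; e_j <= j - 1 becomes "item i is at most i". *)
Definition is_inversion_seq (e : seq nat) : bool :=
  [forall i : 'I_(size e), nth 0 e i <= i].

Definition order_isomorphic (u w : seq nat) : bool :=
  (size u == size w) &&
  [forall a : 'I_(size w), forall b : 'I_(size w),
     ((nth 0 u a < nth 0 u b) == (nth 0 w a < nth 0 w b)) &&
     ((nth 0 u a == nth 0 u b) == (nth 0 w a == nth 0 w b))].

(* For patterns w of length 3. *)
Definition contains (w e : seq nat) : bool :=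
  [exists i1 : 'I_(size e), exists i2 : 'I_(size e), exists i3 : 'I_(size e),
     [&& i1 < i2, i2 < i3 &
         order_isomorphic [:: nth 0 e i1; nth 0 e i2; nth 0 e i3] w]].

Definition avoids (w e : seq nat) : bool := ~~ contains w e.

Definition max_entry (e : seq nat) : nat := \max_(x <- e) x.

(* The entry e_p, with p counted from 1 and the convention e_{n+1} = -1. *)
Definition entry (e : seq nat) (p : nat) : int :=
  if p <= size e then Posz (nth 0 e p.-1) else (-1)%R.

(* The least p >= 1 with e_p > e_{p+1}; one exists with p <= n if n >= 1. *)
Definition fdes (e : seq nat) : nat :=
  (find (fun p => (entry e p.+1 < entry e p)%R) (iota 1 (size e))).+1.

Definition rank (e : seq nat) : int :=
  (Posz (fdes e) - Posz (max_entry e) - 1)%R.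

(* Entries of an inversion sequence of length n are less than n, so tuples over
   'I_n lose none of them. *)
Definition entries n (e : n.-tuple 'I_n) : seq nat := map val e.

Fixpoint fib (k : nat) : nat :=
  match k with
  | 0 => 0
  | 1 => 1
  | (k'.+1 as k1).+1 => fib k1 + fib k'
  end.

(* Main.v *)
(** As e_1 = 0, avoiding 012 means that the positive entries of e are weakly
    decreasing, and then 102 is avoided for free. If e is nonzero with maximum
    m, then m is its first positive entry, so e = 0^(m+a) m^b w with b > 0 and
    w a word over {0, ..., m} that does not start with m and whose positive
    entries are weakly decreasing. Here fdes(e) = m + a + b, hence
    rank(e) = a + b - 1: for rank t there are t + 1 choices of (a, b), and
    independently of them |w| = n - t - 1 - m. Let W(L, m) count the words of
    length L over {0, ..., m} with weakly decreasing positive entries. From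
    W(L+1, m+1) + W(L, m) = 2 W(L, m+1) + W(L+1, m), the sums
    A(N) = W(N-1, 1) + ... + W(0, N) satisfy A(N+2) + A(N) = 3 A(N+1), so that
    A(N) = F_(2N). Those of length L > 0 not starting with m number
    W(L, m) - W(L-1, m), which yields F_(2N) - F_(2N-2) = F_(2N-1) words w for
    N = n - t - 1. *)

Require Import Defs.
From mathcomp Require Import all_boot all_order all_algebra.
From mathcomp Require Import zify.

(** * Lists of the words w and of the sequences built from them *)

Definition pos_nonincreasing : rel nat := fun x y => (x == 0) || (y <= x).

(* A positive first entry c becomes the bound on the later entries, while a
   zero leaves the bound unchanged. *)
Fixpoint words (L m : nat) : seq (seq nat) :=
  if L is L'.+1 then
    [seq c :: w | c <- iota 0 m.+1, w <- words L' (if c == 0 then m else c)]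
  else [:: [::]].

(** Letters are at most [m], so the filter excludes the words that start with [m]; the default 0
    keeps the empty word when [m > 0]. *)
Definition tails (L m : nat) : seq (seq nat) :=
  [seq w <- words L m | head 0 w < m].

(** For a <= t, the block of [m] has length b = t - a + 1, so that a + b - 1 = t. *)
Definition assemble (t m a : nat) (w : seq nat) : seq nat :=
  nseq (m + a) 0 ++ nseq (t - a).+1 m ++ w.

Definition assembled_seqs (n t : nat) : seq (seq nat) :=
  [seq assemble t p.1 p.2 w
     | p <- [seq (m, a) | m <- iota 1 (n - t.+1), a <- iota 0 t.+1],
       w <- tails (n - t.+1 - p.1) p.1].

(** The condition is [pairwise], not [sorted]: 0 is related to every number in both directions, so
    [pos_nonincreasing] is not transitive. *)
Lemma mem_words (L m : nat) (w : seq nat) :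
  (w \in words L m) =
  [&& size w == L, all (leq^~ m) w & pairwise pos_nonincreasing w].
Proof.
elim: L m w => [|L IH] m w; first by case: w.
case: w => [|x w].
  by apply/negP => /allpairsPdep[? [? []]].
apply/allpairsPdep/idP => [[c [v [+ + [-> ->]]]]|].
  rewrite mem_iota add0n IH ltnS eqSS pairwise_cons /pos_nonincreasing.
  move=> /= cm /and3P[-> + ->]; rewrite cm /= andbT.
  case: eqVneq => [_ -> |c0 vc] /=; first by rewrite all_predT.
  by rewrite vc (sub_all _ vc) // => y /leq_trans->.
rewrite eqSS pairwise_cons => /and3P[sw /andP[xm wm] /andP[xw pw]].
exists x, w; split=> //; first by rewrite mem_iota.
rewrite IH sw pw andbT; move: xw; rewrite /pos_nonincreasing.
by case: (x == 0).
Qed.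

Lemma mem_tails (L m : nat) (w : seq nat) :
  (w \in tails L m) =
  [&& head 0 w < m, size w == L, all (leq^~ m) w & pairwise pos_nonincreasing w].
Proof. by rewrite mem_filter mem_words. Qed.

Lemma uniq_words (L m : nat) : uniq (words L m).
Proof.
elim: L m => [|L IH] m //.
apply: allpairs_uniq_dep => [|x _|]; [exact: iota_uniq|exact: IH|].
by move=> [c v] [d w] _ _ /= [-> ->].
Qed.

(** The first positive entry reveals [m + a] by its index and [m] by its value, after which [w] can
    be cut off; hence distinct data give distinct sequences. *)
Lemma assembleK (t m a : nat) (w : seq nat) : 0 < m ->
  [/\ find (leq 1) (assemble t m a w) = m + a,
      nth 0 (assemble t m a w) (m + a) = m &
      drop (m + a + (t - a).+1) (assemble t m a w) = w].
Proof.
move=> m0; rewrite /assemble; split.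
- rewrite find_cat has_nseq andbF size_nseq /= m0; lia.
- by rewrite nth_cat size_nseq ltnn subnn.
- by rewrite catA drop_size_cat // size_cat !size_nseq.
Qed.

Lemma uniq_assembled_seqs (n t : nat) : uniq (assembled_seqs n t).
Proof.
apply: allpairs_uniq_dep.
- apply: allpairs_uniq; [exact: iota_uniq|exact: iota_uniq|].
  by move=> [? ?] [? ?] _ _ /= [-> ->].
- by move=> p _; rewrite filter_uniq // uniq_words.
have pos p : p \in [seq (m, a) | m <- iota 1 (n - t.+1), a <- iota 0 t.+1] ->
    0 < p.1.
  by case/allpairsP=> -[x y] /= []; rewrite mem_iota => /andP[x0 _] _ ->.
move=> g1 g2 /allpairsPdep[[m a] [v [/pos m0 _ ->]]].
move=> /allpairsPdep[[m' a'] [u [/pos m0' _ ->]]] /= eqA.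
have [f1 n1 d1] := assembleK t m a v m0.
have [f2 n2 d2] := assembleK t m' a' u m0'.
move: f1 n1 d1; rewrite eqA f2 => eqk; rewrite -eqk n2 => eqm.
have eqa : a' = a by lia.
by move: d2; rewrite eqm eqa => -> ->.
Qed.

(** * Pattern avoidance as a pairwise condition *)

Lemma order_isomorphic_012 (a b c : nat) :
  order_isomorphic [:: a; b; c] [:: 0; 1; 2] = (a < b < c).
Proof.
apply/andP/andP => [[_ /forallP iso]|[ab bc]].
  have /forallP/(_ (inord 1))/andP[/eqP + _] := iso (inord 0).
  have /forallP/(_ (inord 2))/andP[/eqP + _] := iso (inord 1).
  by rewrite !inordK //= => -> ->.
split=> //; apply/forallP => -[[|[|[|//]]] i]; apply/forallP => -[[|[|[|//]]] j] /=.
all: by apply/andP; split; apply/eqP; lia.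
Qed.

Lemma order_isomorphic_102 (a b c : nat) :
  order_isomorphic [:: a; b; c] [:: 1; 0; 2] = (b < a < c).
Proof.
apply/andP/andP => [[_ /forallP iso]|[ba ac]].
  have /forallP/(_ (inord 0))/andP[/eqP + _] := iso (inord 1).
  have /forallP/(_ (inord 2))/andP[/eqP + _] := iso (inord 0).
  by rewrite !inordK //= => -> ->.
split=> //; apply/forallP => -[[|[|[|//]]] i]; apply/forallP => -[[|[|[|//]]] j] /=.
all: by apply/andP; split; apply/eqP; lia.
Qed.

Lemma is_inversion_seqP (e : seq nat) :
  reflect (forall i, i < size e -> nth 0 e i <= i) (is_inversion_seq e).
Proof.
apply: (iffP forallP) => [inv i ie|inv i]; last exact: inv.
exact: inv (Ordinal ie).
Qed.

Lemma avoids_102_012 (e : seq nat) : is_inversion_seq e ->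
  avoids [:: 1; 0; 2] e && avoids [:: 0; 1; 2] e = pairwise pos_nonincreasing e.
Proof.
move/is_inversion_seqP=> inv; apply/andP/(pairwiseP 0) => [[_ av] i j|noninc].
  rewrite !inE => ie je ij; rewrite /pos_nonincreasing; apply/norP => -[i0].
  rewrite -ltnNge => eij; have i_gt0 : 0 < i by have := inv i ie; lia.
  (* The entry of index 0 is 0 and completes the entries at [i] and [j] to a 012. *)
  case/negP: av; apply/existsP; exists (Ordinal (leq_ltn_trans (leq0n i) ie)).
  apply/existsP; exists (Ordinal ie); apply/existsP; exists (Ordinal je) => /=.
  rewrite i_gt0 ij order_isomorphic_012 eij andbT.
  by have := inv 0 (leq_ltn_trans (leq0n i) ie); lia.
split; apply/negP => /existsP[i /existsP[j /existsP[k /and3P[ij jk]]]].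
  rewrite order_isomorphic_102 => /andP[eji eik].
  have := noninc i k (ltn_ord i) (ltn_ord k) (ltn_trans ij jk).
  by rewrite /pos_nonincreasing; lia.
rewrite order_isomorphic_012 => /andP[eij ejk].
have := noninc j k (ltn_ord j) (ltn_ord k) jk.
by rewrite /pos_nonincreasing; lia.
Qed.

(** * First descent, maximum and rank of an assembled sequence *)

Lemma fdes_cat (s u : seq nat) :
  0 < size s -> sorted leq s -> (u == [::]) || (head 0 u < last 0 s) ->
  fdes (s ++ u) = size s.
Proof.
move=> s0 srt desc; rewrite /fdes.
have -> : iota 1 (size (s ++ u)) =
    iota 1 (size s).-1 ++ size s :: iota (size s).+1 (size u).
  by rewrite size_cat -{1}(prednK s0) addSnnS iotaD /= add1n prednK.
rewrite find_cat ifN /=; last first.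
  apply/hasPn => -[|p]; rewrite mem_iota // /entry size_cat => pP.
  rewrite !ifT; [|lia|lia]; rewrite !nth_cat !ifT; [|lia|lia].
  by have /(sortedP 0)/(_ p) := srt; move=> /= srtp; lia.
rewrite size_iota ifT ?addn0 ?prednK // /entry size_cat leq_addr.
(* For empty [u], the descent is to the conventional entry -1. *)
case: u desc => [|x u] desc; first by rewrite addn0 ltnn.
rewrite -addSnnS leq_addr !nth_cat ltnn subnn prednK // leqnn nth_last ltz_nat.
exact: desc.
Qed.

Lemma last_nseq (T : Type) (y x : T) (k : nat) : last y (nseq k.+1 x) = x.
Proof. by elim: k y => //= k IH y; apply: IH. Qed.

Lemma pairwise_nseq (T : Type) (r : rel T) (x : T) (k : nat) :
  pairwise r (nseq k x) = (k <= 1) || r x x.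
Proof.
by case: k => //=; elim=> //= k ->; rewrite all_nseq; case: k; case: (r x x).
Qed.

Lemma all_leq_max_entry (e : seq nat) : all (leq^~ (max_entry e)) e.
Proof. by apply/allP => x xe; apply: leq_bigmax_seq. Qed.

Lemma max_entry_assemble (t m a : nat) (w : seq nat) :
  all (leq^~ m) w -> max_entry (assemble t m a w) = m.
Proof.
move=> wm; apply/eqP; rewrite eqn_leq; apply/andP; split.
  apply/bigmax_leqP_seq => x + _; move: x; apply/allP.
  by rewrite /assemble !all_cat wm !all_nseq leqnn !orbT.
have /allP := all_leq_max_entry (assemble t m a w); apply.
by rewrite /assemble !mem_cat !mem_nseq eqxx orbT.
Qed.

Lemma pairwise_assemble (t m a : nat) (w : seq nat) : 0 < m ->
  pairwise pos_nonincreasing (assemble t m a w) =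
  all (leq^~ m) w && pairwise pos_nonincreasing w.
Proof.
move=> m0; rewrite /assemble !pairwise_cat.
have -> s : allrel pos_nonincreasing (nseq (m + a) 0) s.
  by apply/allrelP => x y; rewrite mem_nseq => /andP[_ /eqP->].
have refl x : pos_nonincreasing x x by rewrite /pos_nonincreasing leqnn orbT.
rewrite !pairwise_nseq !refl !orbT !andTb; congr (_ && _).
apply/allrelP/allP => [le y yw|le x y].
  have := le m y; rewrite mem_nseq eqxx yw /pos_nonincreasing; lia.
by rewrite mem_nseq => /andP[_ /eqP->] /le; rewrite /pos_nonincreasing orbC => ->.
Qed.

Lemma rank_assemble (t m a : nat) (w : seq nat) :
  0 < m -> a <= t -> head 0 w < m -> all (leq^~ m) w ->
  rank (assemble t m a w) = Posz t.
Proof.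
move=> m0 a_t hw wm; rewrite /rank max_entry_assemble //.
rewrite /assemble catA fdes_cat ?size_cat ?size_nseq.
- lia.
- lia.
- rewrite sorted_pairwise; last exact: leq_trans.
  rewrite pairwise_cat !pairwise_nseq !leqnn !orbT !andbT.
  by apply/allrelP => x y; rewrite mem_nseq => /andP[_ /eqP->].
- by rewrite last_cat last_nseq hw orbT.
Qed.

(** * Decomposition of the avoiding sequences of rank t *)

Lemma nseq_prefix (T : eqType) (y x : T) (e : seq T) : y != x ->
  exists k u, e = nseq k x ++ u /\ head y u != x.
Proof.
move=> yx; elim: e => [|z e [k [u [-> hu]]]]; first by exists 0, [::].
have [->|zx] := eqVneq z x; first by exists k.+1, u.
by exists 0, (z :: nseq k x ++ u).
Qed.

Lemma is_inversion_seq_assemble (t m a : nat) (w : seq nat) :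
  all (leq^~ m) w -> is_inversion_seq (assemble t m a w).
Proof.
move=> wm; apply/is_inversion_seqP => i _; rewrite /assemble.
rewrite nth_cat size_nseq; case: ltnP => [ik|ik]; first by rewrite nth_nseq ik.
have /(all_nthP 0) le_m : all (leq^~ m) (nseq (t - a).+1 m ++ w).
  by rewrite all_cat wm all_nseq leqnn orbT.
have [lt_i|ge_i] := ltnP (i - (m + a)) (size (nseq (t - a).+1 m ++ w)).
  by have := le_m _ lt_i; lia.
by rewrite nth_default.
Qed.

Lemma rank_nseq0 (n : nat) : rank (nseq n.+1 0) = Posz n.
Proof.
rewrite /rank -[nseq _ _]cats0 fdes_cat ?size_nseq //; last first.
  by rewrite sorted_pairwise ?pairwise_nseq ?orbT //; exact: leq_trans.
rewrite cats0; have : max_entry (nseq n.+1 0) <= 0.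
  by apply/bigmax_leqP_seq => x; rewrite mem_nseq => /andP[_ /eqP->].
lia.
Qed.

Lemma mem_assembled_seqs (n t : nat) (e : seq nat) : t <= n - 2 -> 2 <= n ->
  (e \in assembled_seqs n t) =
  [&& size e == n, is_inversion_seq e, avoids [:: 1; 0; 2] e,
      avoids [:: 0; 1; 2] e & rank e == Posz t].
Proof.
move=> tn n2; apply/idP/idP.
  case/allpairsPdep => p [w [/allpairsP[[m a] []]]].
  rewrite !mem_iota => /= mP aP -> /= + -> {p}.
  rewrite mem_tails => /and4P[hw /eqP sw wm pw].
  have inv := is_inversion_seq_assemble t m a w wm.
  have := avoids_102_012 _ inv; rewrite pairwise_assemble ?wm ?pw; last by lia.
  case/andP => -> ->; rewrite inv rank_assemble //=; last by lia.
  by rewrite eqxx /assemble !size_cat !size_nseq sw !andbT; apply/eqP; lia.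
case/and5P=> /eqP sz inv av1 av2 rk.
have := avoids_102_012 _ inv; rewrite av1 av2 /= => /esym pe.
have [k [u [eE hu]]] := nseq_prefix _ 1 0 e isT.
case: u => [|m u] in eE hu.
  (* The zero sequence has rank n - 1, which exceeds t. *)
  move: rk sz; rewrite eE cats0 size_nseq => + kn.
  by rewrite kn -[n](@prednK n) ?rank_nseq0; lia.
(* The remaining copies of [m] are split off; the default [m.+1] differs from [m], so [w] may be
   empty. *)
have [j [w [uE hw]]] := nseq_prefix _ m.+1 m u (negbT (gtn_eqF (ltnSn m))).
have m0 : 0 < m by rewrite /= in hu; lia.
(* The first [m] has index [k], so the inversion bound allows a = k - m. *)
have mk : m <= k.
  have /is_inversion_seqP/(_ k) := inv.
  rewrite eE nth_cat size_nseq ltnn subnn; apply.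
  by rewrite size_cat size_nseq /=; lia.
(* Here b = j + 1, so a + b - 1 is [j + (k - m)]; the rank later identifies it with [t]. *)
have {}eE : e = assemble (j + (k - m)) m (k - m) w.
  by rewrite eE uE /assemble subnKC // addnK.
move: pe; rewrite eE pairwise_assemble // => /andP[wm pw].
have hw' : head 0 w < m.
  by case: w hw wm {uE eE pw} => //= x w + /andP[+ _]; rewrite ltn_neqAle => -> ->.
move: rk sz; rewrite eE rank_assemble //; last by lia.
move=> /eqP[tE]; rewrite /assemble !size_cat !size_nseq => sz.
apply/allpairsPdep; exists (m, k - m), w; split; last by rewrite /= tE.
  by apply/allpairsP; exists (m, k - m); rewrite !mem_iota /=; split=> //; lia.
by rewrite mem_tails /= hw' wm pw andbT /=; apply/eqP; lia.
Qed.

(** * Counting words and tails by Fibonacci numbers *)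

Lemma size_wordsS (L m : nat) : size (words L.+1 m) =
  size (words L m) + \sum_(c < m) size (words L c.+1).
Proof.
rewrite size_allpairs_dep /= sumnE; congr (_ + _).
have -> : iota 1 m = index_iota 1 m.+1 by rewrite /index_iota subn1.
by rewrite big_map big_add1 big_mkord.
Qed.

(** The sums over first letters in [size_wordsS] for [m.+1] and [m] differ by the single term
    [size (words L m.+1)]. *)
Lemma size_words_rec (L m : nat) :
  size (words L.+1 m.+1) + size (words L m) =
  2 * size (words L m.+1) + size (words L.+1 m).
Proof. rewrite !size_wordsS big_ord_recr /=; lia. Qed.

Lemma size_words_m0 (L : nat) : size (words L 0) = 1.
Proof. by elim: L => // L IH; rewrite size_wordsS big_ord0 IH. Qed.

(** The words excluded from the tails are [m.+1] followed by any element of [words L m.+1]. *)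
Lemma size_tails (L m : nat) :
  size (tails L.+1 m.+1) + size (words L m.+1) = size (words L.+1 m.+1).
Proof.
pose v c := words L (if c == 0 then m.+1 else c).
have wordsE : words L.+1 m.+1 =
    [seq c :: w | c <- iota 0 m.+1, w <- v c] ++
    [seq m.+1 :: w | w <- words L m.+1].
  transitivity [seq c :: w | c <- iota 0 m.+2, w <- v c]; first by [].
  by rewrite -[m.+2]addn1 iotaD map_cat flatten_cat /= cats0.
have : all (fun w => head 0 w < m.+1)
    [seq c :: w | c <- iota 0 m.+1, w <- v c].
  by apply/allP => _ /allpairsPdep[c [w [+ _ ->]]]; rewrite mem_iota.
move: wordsE; move: [seq c :: w | c <- _, w <- _] => short.
move=> wordsE /all_filterP shortE.
rewrite /tails wordsE filter_cat !size_cat size_map shortE filter_map.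
rewrite (eq_filter (a2 := pred0)) => [|w /=]; last exact: ltnn.
by rewrite filter_pred0 addn0.
Qed.

Definition diagonal_words (N : nat) : nat :=
  \sum_(m < N) size (words (N - m.+1) m.+1).

Lemma diagonal_wordsS (N : nat) :
  diagonal_words N.+1 = 1 + \sum_(m < N) size (words (N - m) m.+1).
Proof. by rewrite /diagonal_words big_ord_recr /= subnn addnC. Qed.

Lemma diagonal_words_rec (N : nat) :
  diagonal_words N.+2 + diagonal_words N = 3 * diagonal_words N.+1.
Proof.
(* Summed over L + m = N, the four terms of [size_words_rec] become A(N+2) - 1, A(N) + 1, 2 A(N+1)
   and A(N+1). *)
have rec : \sum_(m < N.+1) size (words (N - m).+1 m.+1) +
    \sum_(m < N.+1) size (words (N - m) m) =
    2 * diagonal_words N.+1 + \sum_(m < N.+1) size (words (N - m).+1 m).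
  rewrite big_distrr -!big_split; apply: eq_bigr => m _.
  exact: size_words_rec.
have sum1 : diagonal_words N.+2 =
    1 + \sum_(m < N.+1) size (words (N - m).+1 m.+1).
  rewrite diagonal_wordsS; congr (_ + _); apply: eq_bigr => m _.
  by rewrite subSn // -ltnS.
have sum2 : \sum_(m < N.+1) size (words (N - m) m) = 1 + diagonal_words N.
  by rewrite big_ord_recl size_words_m0.
have sum3 : \sum_(m < N.+1) size (words (N - m).+1 m) = diagonal_words N.+1.
  rewrite big_ord_recl size_words_m0 diagonal_wordsS; congr (_ + _).
  by apply: eq_bigr => m _; rewrite subnSK.
lia.
Qed.

(** F_(2N) has the same recurrence and initial values; the order is two, so the induction carries
    consecutive pairs. *)
Lemma diagonal_words_fib (N : nat) : diagonal_words N = fib (2 * N).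
Proof.
suff: diagonal_words N = fib (2 * N) /\ diagonal_words N.+1 = fib (2 * N.+1).
  by case.
elim: N => [|N [IH1 IH2]].
  by rewrite diagonal_wordsS /diagonal_words !big_ord0.
split=> //; have := diagonal_words_rec N; rewrite IH1 IH2.
by rewrite !mulnS !add2n /=; lia.
Qed.

Lemma sum_size_tails (N : nat) :
  \sum_(m < N.+1) size (tails (N - m) m.+1) = fib (2 * N).+1.
Proof.
(* The empty tail is counted apart, since [size_tails] concerns positive lengths. *)
have tails0 : size (tails 0 N.+1) = 1 by [].
rewrite big_ord_recr /= subnn tails0.
have split_sum : \sum_(m < N) size (tails (N - m) m.+1) + diagonal_words N =
    \sum_(m < N) size (words (N - m) m.+1).
  rewrite -big_split; apply: eq_bigr => m _.
  by rewrite -(subnSK (ltn_ord m)); exact: size_tails.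
have := diagonal_wordsS N; rewrite -split_sum !diagonal_words_fib mulnS add2n /=.
lia.
Qed.

Lemma size_assembled_seqs (n t : nat) : 2 <= n -> t <= n - 2 ->
  size (assembled_seqs n t) = (t + 1) * fib (2 * n - 2 * t - 3).
Proof.
move=> n2 tn; rewrite size_allpairs_dep sumnE big_map big_allpairs_dep.
have -> : iota 1 (n - t.+1) = index_iota 1 (n - t.+1).+1.
  by rewrite /index_iota subn1.
rewrite big_add1 big_mkord.
(* The number of tails does not depend on [a], whose t + 1 values give the factor. *)
transitivity (\sum_(m < n - t.+1) t.+1 * size (tails (n - t.+1 - m.+1) m.+1)).
  by apply: eq_bigr => m _; rewrite -(sum_nat_const_nat 0 t.+1).
rewrite -big_distrr addn1; congr (_ * _).
have [N NE] : exists N, n - t.+1 = N.+1 by exists (n - t.+2); lia.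
rewrite NE; transitivity (fib (2 * N).+1); last by congr fib; lia.
rewrite -sum_size_tails; apply: eq_bigr => m _.
by rewrite subSS.
Qed.

(** * Transfer from lists to tuples over ['I_n] *)

Lemma card_entries (n : nat) (P : pred (seq nat)) (l : seq (seq nat)) :
  uniq l ->
  (forall e, (e \in l) = [&& size e == n, all (gtn n) e & P e]) ->
  #|[set e : n.-tuple 'I_n | P (entries e)]| = size l.
Proof.
move=> ul lP.
have inj : injective (@entries n).
  by move=> e1 e2 /(inj_map val_inj) /val_inj.
rewrite cardE -(size_map (@entries n)); apply: perm_size.
apply: uniq_perm => // [|e]; first by rewrite map_inj_uniq ?enum_uniq.
rewrite lP; apply/mapP/and3P => [[u + ->]|[/eqP se /allP ne Pe]].
  rewrite mem_enum inE => ->; rewrite size_map size_tuple eqxx; split=> //.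
  by apply/allP => _ /mapP[i _ ->]; exact: ltn_ord.
(* All entries are below [n], so [insub] drops none and [e] lifts to a tuple. *)
have eE : map val (pmap (insub : nat -> option 'I_n) e) = e.
  rewrite pmap_filter; last exact: insubK.
  by apply/all_filterP/allP => x /ne; rewrite isSome_insub.
have sz : size (pmap (insub : nat -> option 'I_n) e) == n.
  by rewrite -(size_map val) eE se.
by exists (Tuple sz); rewrite ?mem_enum ?inE /entries /= eE.
Qed.

Theorem proposition5p5 (n t : nat) (hn : 2 <= n) (ht : t <= n - 2) :
  #|[set e : n.-tuple 'I_n | [&& is_inversion_seq (entries e),
                                 avoids [:: 1; 0; 2] (entries e),
                                 avoids [:: 0; 1; 2] (entries e) &
                                 rank (entries e) == Posz t]]|
  = (t + 1) * fib (2 * n - 2 * t - 3).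
Proof.
rewrite -size_assembled_seqs //.
pose P e := [&& is_inversion_seq e, avoids [:: 1; 0; 2] e,
  avoids [:: 0; 1; 2] e & rank e == Posz t].
apply: (card_entries n P) => [|e]; first exact: uniq_assembled_seqs.
rewrite mem_assembled_seqs // /P.
have [/= se|//] := eqVneq (size e) n.
case inv: (is_inversion_seq e); rewrite ?andbF //=.
(* Each entry is at most its index, which is below [n]. *)
suff -> : all (gtn n) e by [].
apply/(all_nthP 0) => i ie /=.
by have /is_inversion_seqP/(_ i ie) := inv; lia.
Qed.
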